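(* Let $(I,\le_I)$ be a poset and for each $i\in I$ let $(P_i,\le_i)$ be a poset with least element $0_i$. (a) If $\alpha\in[\omega,\omega_1)$ and $I$ and every $P_i$ are $\alpha$-wqo, then the Dress–Schiffels product $\otimes^{DS}_{i\in I}P_i$ is $\alpha$-wqo. (b) If $I$ and every $P_i$ are bqo, then $\otimes^{DS}_{i\in I}P_i$ is bqo. (c) If $I$ and every $P_i$ are $\sigma$-bqo, then $\otimes^{DS}_{i\in I}P_i$ is $\sigma$-bqo.
   Context: $\otimes^{DS}_{i\in I}P_i$ is the set of functions $f$ on $I$ with $f(i)\in P_i$ for all $i$ and finite support $\mathrm{supp}(f)=\{i: f(i)\ne 0_i\}$, ordered by $f\le_{DS}g$ iff $f(i)<_i g(i)$ for every $i$ that is $\le_I$-maximal in $\Delta(f,g)=\{i: f(i)\ne g(i)\}$. A poset is wqo if it has no infinite antichain and no infinite strictly decreasing sequence. A barrier is an infinite set $B\subseteq[\omega]^{<\omega}$ which is an antichain under $\subseteq$ and such that every infinite subset of $\bigcup B$ has an initial segment (set of its $k$ smallest elements, some $k$) in $B$; barriers are well-ordered lexicographically (comparing increasing enumerations) and the type of $B$ is this order type. For nonempty finite $r,s\subseteq\omega$, $r\triangleleft s$ means $\min r<\min s$ and $r\setminus\{\min r\}$ is a proper initial segment of $s$. A map $f:B\to P$ is good if there are $s\triangleleft t$ in $B$ with $f(s)\le_P f(t)$. $P$ is $\alpha$-wqo ($\alpha<\omega_1$) iff every map from a barrier of type $\le\alpha$ into $P$ is good; $P$ is bqo iff it is $\alpha$-wqo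 for all $\alpha<\omega_1$. A poset is $\sigma$-bqo if it is wqo and is a union of countably many subsets each bqo in the induced order. *)

(* Defs.v *)
From HB Require Import structures.
From mathcomp Require Import all_boot all_order finmap.
From mathcomp Require Import all_classical.

Set Implicit Arguments.
Unset Strict Implicit.
Unset Printing Implicit Defensive.

Import Order.TTheory.
Local Open Scope classical_set_scope.
Local Open Scope order_scope.

(* Countable ordinals, represented by countable well-ordered sets: the ordinal
   meant is the order type of the carrier.  It is at least omega iff the carrier
   is infinite. *)
Record countable_ordinal := CountableOrdinal {
  ordinal_disp : Order.disp_t;
  ordinal_car :> orderType ordinal_disp;
  ordinal_countable : countable [set: ordinal_car];
  ordinal_wo : wochoice.well_order (<=%O : rel ordinal_car)
}.

Section Barriers.
Implicit Types (r s t : {fset nat}) (X Y : set nat) (B : set {fset nat}).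

(* For finite X: X consists of the k smallest elements of Y, for some k. *)
Definition initial_segment X Y :=
  X `<=` Y /\ forall m n, Y m -> X n -> (m <= n)%N -> X m.

Definition barrier B :=
  [/\ infinite_set B,
      forall s t, B s -> B t -> (s `<=` t)%fset -> s = t
    & forall X, X `<=` \bigcup_(s in B) [set` s] -> infinite_set X ->
        exists2 s, B s & initial_segment [set` s] X].

Definition incr_enum s : seq nat := sort leq s.

Definition lex_le s t : bool :=
  ((incr_enum s : seqlexi nat) <= (incr_enum t : seqlexi nat))%O.

(* type(B) <= a : (B, lex) is isomorphic to an initial segment of a. *)
Definition barrier_type_le B (a : countable_ordinal) :=
  exists g : {fset nat} -> a,
    (forall s t, B s -> B t -> (g s <= g t) = lex_le s t) /\
    (forall s x, B s -> x <= g s -> exists2 t, B t & g t = x).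

(* For nonempty s; the value at the empty set is irrelevant. *)
Definition fset_min s : nat := head 0%N (incr_enum s).

Definition triangle r s :=
  let r' := (r `\ fset_min r)%fset in
  [/\ r != fset0, s != fset0, (fset_min r < fset_min s)%N,
      initial_segment [set` r'] [set` s] & r' != s].

End Barriers.

Section WqoBqo.
Context {d : Order.disp_t} {T : porderType d}.
Implicit Type A : set T.

(* Only the values of f on B matter; a total f is harmless because a barrier
   is nonempty. *)
Definition good (B : set {fset nat}) (f : {fset nat} -> T) :=
  exists s t, [/\ B s, B t, triangle s t & f s <= f t].

(* The subset A, with the induced order, is alpha-wqo, resp. bqo. *)
Definition alpha_wqo_on (a : countable_ordinal) A :=
  forall (B : set {fset nat}) (f : {fset nat} -> T),
    barrier B -> barrier_type_le B a -> (forall s, B s -> A (f s)) ->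
    good B f.

Definition bqo_on A := forall a : countable_ordinal, alpha_wqo_on a A.

End WqoBqo.

Section WqoBqoTypes.
Context {d : Order.disp_t} (T : porderType d).

Definition alpha_wqo (a : countable_ordinal) := alpha_wqo_on a [set: T].

Definition bqo := bqo_on [set: T].

Definition wqo :=
  (~ exists A : set T,
      infinite_set A /\ forall x y, A x -> A y -> x <> y -> x >< y) /\
  (~ exists u : nat -> T, forall n, u n.+1 < u n).

Definition sigma_bqo :=
  wqo /\ exists A : nat -> set T,
    \bigcup_n A n = [set: T] /\ forall n, bqo_on (A n).

End WqoBqoTypes.

Definition maximals {d : Order.disp_t} {I : porderType d} (D : set I) : set I :=
  [set i | D i /\ forall j, D j -> ~~ (i < j)].

Lemma finite_maximal_above d (I : porderType d) (D : set I) (i : I) :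
  finite_set D -> D i -> exists2 j, i <= j & maximals D j.
Proof.
move=> /finite_seqP[s ->] /=.
have [n] := ubnP (count (fun k => i < k) s); elim: n i => // n IHn i lin si.
have [/hasP[k sk ltik]|/hasPn nlt] := boolP (has (fun k => i < k) s); last first.
  by exists i => //; split.
have [|j lekj maxj] := IHn k _ sk.
  rewrite -ltnS; apply: leq_trans lin; rewrite ltnS.
  have sub : subpred (fun x => k < x) (fun x => (i < x) && (x != k)).
    by move=> x /= ltkx; rewrite (lt_trans ltik ltkx) gt_eqF.
  apply: (leq_ltn_trans (sub_count sub s)).
  have -> : count (fun x => (i < x) && (x != k)) s =
            count (predC (pred1 k)) [seq x <- s | i < x].
    by rewrite count_filter; apply: eq_count => x /=; rewrite andbC.
  rewrite -[X in (_ < X)%N]size_filter -(count_predC (pred1 k)).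
  rewrite -[X in (X < _)%N]add0n ltn_add2r -has_count.
  by apply/hasP; exists k => /=; rewrite ?mem_filter ?ltik ?eqxx.
by exists j => //; exact: le_trans (ltW ltik) lekj.
Qed.

Record ds_product {dI d : Order.disp_t} (I : porderType dI)
    (P : I -> bPOrderType d) := DSProduct {
  ds_fun :> forall i, P i;
  ds_finite_support : finite_set [set i | ds_fun i <> \bot]
}.

Section DressSchiffels.
Context {dI d : Order.disp_t} {I : porderType dI} {P : I -> bPOrderType d}.
Implicit Types f g h : ds_product P.

HB.instance Definition _ := gen_eqMixin (ds_product P).
HB.instance Definition _ := gen_choiceMixin (ds_product P).

Definition ds_diff f g : set I := [set i | f i <> g i].

Definition ds_le f g : bool :=
  `[< forall i, maximals (ds_diff f g) i -> f i < g i >].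

Lemma ds_diff_finite f g : finite_set (ds_diff f g).
Proof.
apply: (@sub_finite_set _ _ ([set i | f i <> \bot] `|` [set i | g i <> \bot])).
  move=> i /= fgi; have [fi|] := pselect (f i = \bot); last by left.
  by right => gi; apply: fgi; rewrite fi gi.
by rewrite finite_setU; split; exact: ds_finite_support.
Qed.

Lemma ds_ext f g : (forall i, f i = g i) -> f = g.
Proof.
case: f g => [f pf] [g pg] /= fg.
have E : f = g by apply: functional_extensionality_dep.
by subst g; rewrite (Prop_irrelevance pf pg).
Qed.

Lemma ds_le_refl : reflexive ds_le.
Proof. by move=> f; apply/asboolP => i []. Qed.

Lemma ds_le_anti : antisymmetric ds_le.
Proof.
move=> f g /andP[/asboolP fg /asboolP gf]; apply: ds_ext => i.
apply: contrapT => fgi.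
have [j _ maxj] := finite_maximal_above (ds_diff_finite f g) fgi.
have dC : ds_diff g f = ds_diff f g.
  by apply/seteqP; split => k /= + E; apply; rewrite E.
have := gf j; rewrite dC => /(_ maxj) gfj.
by have := lt_trans (fg j maxj) gfj; rewrite ltxx.
Qed.

Lemma ds_le_trans : transitive ds_le.
Proof.
move=> g f h /asboolP fg /asboolP gh; apply/asboolP => i [fhi maxi].
pose D := ds_diff f g `|` ds_diff g h.
have finD : finite_set D by rewrite finite_setU; split; exact: ds_diff_finite.
have Di : D i.
  have [fgi|] := pselect (f i = g i); last by left.
  by right; rewrite /ds_diff /= -fgi.
have step j : maximals D j -> f j < h j.
  move=> [Dj maxj].
  have [fgj|fgj] := pselect (f j = g j).
    rewrite fgj; apply: gh; split; first by case: Dj.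
    by move=> k ghk; apply: maxj; right.
  have ltfg : f j < g j by apply: fg; split=> // k fgk; apply: maxj; left.
  have [<-//|ghj] := pselect (g j = h j).
  by apply: (lt_trans ltfg); apply: gh; split=> // k ghk; apply: maxj; right.
have [j leij maxj] := finite_maximal_above finD Di.
have ltj := step j maxj.
have fhj : ds_diff f h j by move=> E; move: ltj; rewrite E ltxx.
move: leij; rewrite le_eqVlt (negbTE (maxi j fhj)) orbF => /eqP ->.
exact: ltj.
Qed.

Fact ds_display : Order.disp_t. Proof. exact: (Order.Disp tt tt). Qed.

HB.instance Definition _ := Order.Le_isPOrder.Build ds_display (ds_product P)
  ds_le_refl ds_le_anti ds_le_trans.

Lemma ds_leE f g : (f <= g) = ds_le f g. Proof. by []. Qed.

End DressSchiffels.

(* Main.v *)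
(** Let [f] be a bad array on a barrier [B] with values in the product.  Whenever
    [s ◁ t] there is an index [c s t], maximal in the difference of [f s] and
    [f t], at which [f s] is not below [f t]; it lies in the finite support of
    [f s].  By a fusion argument based on Galvin's lemma, after passing to a
    sub-barrier [c s t = i s] depends on [s] only; so [i] is defined on a
    sub-barrier of [B] itself rather than on pairs, and the type does not grow.
    By Ramsey one of three cases occurs on a further sub-barrier:  [i] is bad in
    [I]; or [i] is constant, and the corresponding coordinate of [f] is bad in
    that [P i]; or [i] is strictly increasing along [◁], which is impossible
    because the part of the support of [f s] above [i s] would shrink strictly
    along an infinite [◁]-chain.
    All indices and coordinates used lie in the supports, so for the [sigma]-bqo
    case the pieces of the product are the functions whose supports and nonzero
    values lie in the first [n] pieces of the factors. *)

Require Import Defs.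
From mathcomp Require Import all_boot all_order finmap.
From mathcomp Require Import all_classical.

Set Implicit Arguments.
Unset Strict Implicit.
Unset Printing Implicit Defensive.

Import Order.TTheory.
Local Open Scope classical_set_scope.

(** * Galvin's lemma *)

Section Ramsey.
Implicit Types (r s t u v : {fset nat}) (X Y Z : set nat).

Definition above u X : set nat :=
  [set n | X n /\ forall m, m \in u -> m < n].

Lemma above_sub u X : above u X `<=` X.
Proof. by move=> n []. Qed.

Lemma aboveS u X Y : X `<=` Y -> above u X `<=` above u Y.
Proof. by move=> XY n [/XY]. Qed.

Lemma above0 X : above fset0 X = X.
Proof. by apply/seteqP; split => [n []|n Xn] //; split. Qed.

Lemma above_id u X : above u (above u X) = above u X.
Proof. by apply/seteqP; split => [n []//|n [Xn un]]; split. Qed.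

Lemma above_infinite u X : infinite_set X -> infinite_set (above u X).
Proof.
move=> Xinf.
apply: (@sub_infinite_set _ (X `\` `I_(\max_(m <- u) m).+1)); last first.
  by apply: infinite_setD => //; exact: finite_II.
move=> n [Xn /negP]; rewrite -leqNgt => un; split=> // m mu.
by apply: leq_trans un; rewrite ltnS; by rewrite (big_rem m) //= leq_maxl.
Qed.

Lemma nat_set_min X : X !=set0 -> exists2 m, X m & forall n, X n -> m <= n.
Proof.
move=> [n Xn]; have ex : exists n, `[< X n >] by exists n; apply/asboolP.
by case: (ex_minnP ex) => m /asboolP Xm mmin; exists m => // k Xk; apply/mmin/asboolP.
Qed.

Lemma unbounded_infinite X :
  (forall n, exists2 m, X m & n <= m) -> infinite_set X.
Proof.
move=> unb /finite_seqP[s Xs]; have [m] := unb (\max_(n <- s) n).+1.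
by rewrite Xs /= => ms; rewrite (big_rem m) //= leqNgt ltnS leq_maxl.
Qed.

(** A diagonal construction. Points are chosen one at a time from a shrinking reservoir; after each
    choice the reservoir is thinned so that [Phi u] holds for each of the finitely many sets [u] of
    points chosen so far. The limit set consists of all chosen points. *)
Lemma fusion (Phi : {fset nat} -> set nat -> Prop) X :
  infinite_set X ->
  (forall u Y Z, Z `<=` Y -> infinite_set Z -> Phi u Y -> Phi u Z) ->
  (forall u Y, infinite_set Y -> Y `<=` X ->
     exists Z, [/\ infinite_set Z, Z `<=` Y & Phi u Z]) ->
  exists Y, [/\ infinite_set Y, Y `<=` X &
    forall u, [set` u] `<=` Y -> Phi u (above u Y)].
Proof.
move=> Xinf Phi_sub Phi_dense.
have thin (us : seq {fset nat}) Y : infinite_set Y -> Y `<=` X ->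
    exists Z, [/\ infinite_set Z, Z `<=` Y & forall u, u \in us -> Phi u Z].
  move=> Yinf YX; elim: us => [|u us [Z [Zinf ZY usZ]]]; first by exists Y; split.
  have [W [Winf WZ uW]] := Phi_dense u Z Zinf (subset_trans ZY YX).
  exists W; split=> // [|v]; first exact: subset_trans ZY.
  by rewrite inE => /predU1P[->//|/usZ]; exact: Phi_sub.
(* A stage pairs the points chosen so far with the reservoir; the equation with [above] says that
   the reservoir lies beyond every chosen point. *)
pose valid (st : {fset nat} * set nat) := [/\ infinite_set st.2, st.2 `<=` X,
  above st.1 st.2 = st.2 & forall u, (u `<=` st.1)%fset -> Phi u st.2].
(* Validity is a premise inside [next], so that the choice function can be total. *)
pose next (st st' : {fset nat} * set nat) := valid st -> [/\ valid st', st'.2 `<=` st.2 &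
  exists2 x, st.2 x & st'.1 = (x |` st.1)%fset].
have /choice[f fP] : forall st, exists st', next st st'.
  move=> [F Y]; have [V|nV] := pselect (valid (F, Y)); last by exists (F, Y) => /nV.
  have [/= Yinf YX FY _] := V; have [x Yx] := infinite_setN0 Yinf.
  have [||Z [Zinf ZY PZ]] := @thin (fpowerset (x |` F)%fset) (above [fset x]%fset Y).
  - exact: above_infinite.
  - by apply: subset_trans YX; exact: above_sub.
  have ZY' : Z `<=` Y by apply: subset_trans ZY _; exact: above_sub.
  exists ((x |` F)%fset, Z) => _; split=> //=; last by exists x.
  split=> //=; first exact: subset_trans YX.
    apply/seteqP; split=> [n []//|n Zn]; split=> // m; rewrite !inE => /orP[/eqP->|mF].
      by have [_] := ZY _ Zn; apply; rewrite !inE.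
    by have := ZY' _ Zn; rewrite -FY => -[_]; apply.
  by move=> u uF; apply: PZ; rewrite fpowersetE.
have [Y0 [Y0inf Y0X PY0]] := Phi_dense fset0 X Xinf (@subset_refl _ X).
pose st n := iter n f (fset0, Y0).
have V n : valid (st n).
  elim: n => [|n IH]; last by have [] := fP _ IH.
  by split=> //=; [rewrite above0|move=> u; rewrite fsubset0 => /eqP->].
have sub2 m n : m <= n -> (st n).2 `<=` (st m).2.
  move=> /subnK <-; elim: (n - m) => // k IH; apply: subset_trans IH.
  by rewrite addSn; have [] := fP _ (V (k + m)).
have ex n : exists2 x, (st n).2 x & (st n.+1).1 = (x |` (st n).1)%fset.
  by have [] := fP _ (V n).
have sub1 m n : m <= n -> ((st m).1 `<=` (st n).1)%fset.
  move=> /subnK <-; elim: (n - m) => // k IH; apply: fsubset_trans IH _.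
  by rewrite addSn; have [x _ ->] := ex (k + m); exact: fsubsetUr.
have new m n y : y \in (st n).1 -> y \notin (st m).1 -> (st m).2 y.
  elim: n => [|n IH]; first by rewrite inE.
  have [x xn E] := ex n; rewrite E !inE => /orP[/eqP-> xm|]; last exact: IH.
  case: (leqP m n) => [mn|nm]; first exact: sub2 mn _ xn.
  by case/negP: xm; apply: (fsubsetP (sub1 _ _ nm)); rewrite E !inE eqxx.
set Yw := [set x | exists n, x \in (st n).1].
have Yw_inf : infinite_set Yw.
  apply: unbounded_infinite => n; elim: n => [|n [y [m ym] ny]].
      by have [x _ E] := ex 0; exists x => //; exists 1; rewrite E !inE eqxx.
    have [x xm E] := ex m; exists x; first by exists m.+1; rewrite E !inE eqxx.
    have [_ _ FY _] := V m; move: xm; rewrite -FY => -[_ /(_ _ ym)].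
    exact: leq_trans.
exists Yw; split=> //.
  by move=> y [n yn]; apply: (Y0X _ (@new 0 n y yn _)); rewrite inE.
move=> u uY.
(* By minimality of the stage [n], the point added last belongs to [u]. Hence every limit point
   above [u] was chosen after stage [n] and lies in its reservoir, for which [Phi u] was
   arranged. *)
have [n un nmin] : exists2 n, (u `<=` (st n).1)%fset & forall m, (u `<=` (st m).1)%fset -> n <= m.
  apply: (@nat_set_min [set n | (u `<=` (st n).1)%fset]).
  have [n un] : exists n, forall x, x \in enum_fset u -> x \in (st n).1.
    have: {subset enum_fset u <= u} by [].
    elim: (enum_fset u) => [|x s IH] su; first by exists 0.
    have [|n sn] := IH; first by move=> y ys; apply: su; rewrite inE ys orbT.
    have [|m xm] := uY x; first by apply: su; rewrite inE eqxx.
    exists (maxn m n) => y; rewrite inE => /predU1P[->|/sn].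
      by apply: (fsubsetP (sub1 _ _ (leq_maxl m n))).
    by apply: (fsubsetP (sub1 _ _ (leq_maxr m n))).
  by exists n; apply/fsubsetP.
have [_ _ _ /(_ u un)] := V n; apply: Phi_sub; last first.
  exact: above_infinite.
move=> y [[m ym] uy]; apply: new ym _; apply/negP => yn.
case: n => [|n] in un nmin yn *; first by rewrite inE in yn.
have [x xn E] := ex n; have xu : x \in u.
  apply: contraT => xu; suff: n < n by rewrite ltnn.
  apply: nmin; apply/fsubsetP => z zu.
  have := fsubsetP un _ zu; rewrite E !inE => /orP[/eqP zx|//].
  by rewrite -zx zu in xu.
have xy := uy _ xu; move: yn; rewrite E !inE => /orP[/eqP yx|yn].
  by rewrite yx ltnn in xy.
have [_ _ FY _] := V n; move: xn; rewrite -FY => -[_ /(_ _ yn)].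
by move=> /(ltn_trans xy); rewrite ltnn.
Qed.

Lemma fset_ind_max (Q : {fset nat} -> Prop) :
  Q fset0 ->
  (forall u n, (forall m, m \in u -> m < n) -> Q u -> Q (n |` u)%fset) ->
  forall u, Q u.
Proof.
move=> Q0 QS u; suff H n v : (forall m, m \in v -> m < n) -> Q v.
  apply: (H (\max_(m <- u) m).+1) => m mu.
  by rewrite ltnS (big_rem m) //= leq_maxl.
elim: n v => [|n IH] v vn.
  suff -> : v = fset0 by [].
  by apply/fsetP => m; rewrite inE; apply/negP => /vn.
have [nv|nv] := boolP (n \in v); last first.
  apply: IH => m mv; have := vn m mv; rewrite ltnS leq_eqVlt.
  by case/predU1P => // mn; rewrite -mn mv in nv.
rewrite -(fsetD1K nv).
have H m : m \in (v `\ n)%fset -> m < n.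
  by rewrite !inE => /andP[mn /vn]; rewrite ltnS leq_eqVlt (negbTE mn).
by apply: QS => //; exact: IH.
Qed.

Local Notation init s X := (initial_segment [set` s] X).

Lemma init_total s t X : init s X -> init t X -> (s `<=` t)%fset \/ (t `<=` s)%fset.
Proof.
move=> [sX sI] [tX tI]; have [|/fsubsetPn[m ms mt]] := boolP (s `<=` t)%fset.
  by left.
right; apply/fsubsetP => n nt; have [nm|mn] := leqP n m.
  by apply: (sI n m) => //; exact: tX.
by case/negP: mt; apply: (tI m n) => //; [exact: sX|exact: ltnW].
Qed.

Lemma init_above s X : init s ([set` s] `|` above s X).
Proof.
split=> [n ns|m n]; first by left.
by case=> // -[_ sm] ns nm; have := sm _ ns; rewrite ltnNge nm.
Qed.

(** Nash-Williams' accept/reject argument. A first fusion makes [Y] accept or reject each of its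
    finite subsets. If [fset0] is accepted, the second alternative holds. Otherwise a second fusion
    makes rejection pass from [u] to [u] with a larger point added, so all finite subsets of the
    result are rejected, and none of them can be in [Fam]. *)
Lemma galvin (Fam : set {fset nat}) X : infinite_set X ->
  exists Y, [/\ infinite_set Y, Y `<=` X &
    (forall s, Fam s -> ~ [set` s] `<=` Y) \/
    (forall Z, infinite_set Z -> Z `<=` Y -> exists2 s, Fam s & init s Z)].
Proof.
move=> Xinf.
pose acc u Y := forall Z, infinite_set Z -> Z `<=` above u Y ->
  exists2 s, Fam s & init s ([set` u] `|` Z).
pose rej u Y := forall Z, infinite_set Z -> Z `<=` Y -> ~ acc u Z.
have acc_sub u Y Z : Z `<=` Y -> acc u Y -> acc u Z.
  move=> ZY uY W Winf WZ; apply: uY => //; apply: subset_trans WZ _.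
  exact: aboveS.
have rej_above u Y : rej u (above u Y) -> rej u Y.
  move=> rY Z Zinf ZY; rewrite /acc -above_id; apply: rY (aboveS ZY).
  exact: above_infinite.
have [|||Y [Yinf YX decY]] := @fusion (fun u Y => acc u Y \/ rej u Y) X.
- by [].
- move=> u Y Z ZY Zinf [/(acc_sub _ _ _ ZY)|rY]; first by left.
  by right=> W Winf WZ; apply: rY => //; exact: subset_trans ZY.
- move=> u Y Yinf YX; have [[Z [Zinf ZY uZ]]|nacc] :=
    pselect (exists Z, [/\ infinite_set Z, Z `<=` Y & acc u Z]).
    by exists Z; split=> //; left.
  exists Y; split=> //; right=> Z Zinf ZY uZ.
  by apply: nacc; exists Z.
have {}decY u : [set` u] `<=` Y -> ~ acc u Y -> rej u Y.
  by move=> /decY[]; [rewrite /acc above_id|move=> /rej_above].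
have [acc0|/decY nacc0] := pselect (acc fset0 Y).
  exists Y; split=> //; right=> Z Zinf ZY.
  have [] := acc0 _ Zinf; first by rewrite above0.
  by move=> s Fs; rewrite set_fset0 set0U; exists s.
have rej0 : rej fset0 Y by apply: nacc0 => n /=; rewrite inE.
pose Phi u Z := [set` u] `<=` Y -> rej u Y ->
  forall n, Z n -> (forall m, m \in u -> m < n) -> rej (n |` u)%fset Y.
have [|||W [Winf WY PhiW]] := @fusion Phi Y.
- by [].
- by move=> u Z Z' Z'Z _ PZ uY /(PZ uY) + n /Z'Z; apply.
- move=> u Z Zinf ZY; have [[uY ru]|nuY] := pselect ([set` u] `<=` Y /\ rej u Y); last first.
    by exists Z; split=> // uY ru; case: nuY.
  (* The points whose addition to [u] is accepted. Were there infinitely many, [W] would accept [u]: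
     any infinite [V] inside [W] splits into its minimum [n] and a rest, and [n] added to [u] is
     accepted. This contradicts the rejection of [u]. *)
  pose W := [set n | above u Z n /\ acc (n |` u)%fset Y].
  have Wfin : finite_set W.
    apply: contrapT => Winf; apply: (ru W Winf).
      by move=> n [[/ZY]].
    move=> V Vinf VW; have [n Vn nmin] := nat_set_min (infinite_setN0 Vinf).
    have [[_ aun] _] := VW _ Vn.
    have [_ +] := above_sub (VW _ Vn).
    move=> /(_ (above [fset n]%fset V) (above_infinite Vinf))[|s Fs sV].
      move=> m [Vm nm]; split; first by apply/ZY; have [[[]]] := VW _ Vm.
      move=> k; rewrite !inE => /orP[/eqP->|]; first by apply: nm; rewrite inE.
      by have [_] := VW _ Vm; apply.
    exists s => //; suff -> : [set` u] `|` V =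
        [set` (n |` u)%fset] `|` above [fset n]%fset V by [].
    apply/seteqP; split=> m /=; rewrite !inE.
      move=> [->|Vm]; first by rewrite orbT; left.
      have := nmin _ Vm; rewrite leq_eqVlt eq_sym => /orP[->|nm]; first by left.
      by right; split=> // k; rewrite inE => /eqP->.
    by case=> [/orP[/eqP->|]|[]]; [right|left|right].
  exists (above u Z `\` W); split.
  - by apply: infinite_setD => //; exact: above_infinite.
  - by apply: subset_trans (@above_sub u Z) => n [].
  move=> _ _ n [uZn nW] un; apply: decY; last by move=> accn; apply: nW.
  by move=> m /=; rewrite !inE => /orP[/eqP->|/uY//]; exact/ZY/(above_sub uZn).
exists W; split=> //; first exact: subset_trans YX.
(* A member [s] of [Fam] is accepted by [Y], being itself an initial segment of [s] followed by
   anything above it; so it cannot be rejected. *)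
left=> s Fs sW; suff rs : rej s Y.
  apply: (rs Y) => // Z Zinf ZY; exists s => //.
  suff -> : Z = above s Z by exact: init_above.
  by apply/seteqP; split=> [n Zn|n []//]; split=> //; have [_] := ZY _ Zn.
elim/fset_ind_max: s sW {Fs} => // u n un IH nuW.
have uW : [set` u] `<=` W by move=> m mu; apply: nuW; rewrite /= !inE mu orbT.
apply: (PhiW u uW) => //; [exact: subset_trans WY|exact: IH|].
by split=> //; apply: nuW; rewrite /= !inE eqxx.
Qed.

(** * Barriers *)

Implicit Types B C : set {fset nat}.

Local Notation base B := (\bigcup_(s in B) [set` s]).

Lemma barrier_neq0 B s : barrier B -> B s -> s != fset0.
Proof.
move=> [Binf Banti _] Bs; apply/eqP => s0; apply: Binf.
apply: (@sub_finite_set _ _ [set s]) => // t Bt /=.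
by apply/esym/Banti => //; rewrite s0 fsub0set.
Qed.

Lemma barrier_infinite B : barrier B -> infinite_set B.
Proof. by case. Qed.

Lemma barrier_init_uniq B X s t :
  barrier B -> B s -> B t -> init s X -> init t X -> s = t.
Proof.
move=> [_ Banti _] Bs Bt sX tX.
by have [/Banti|/Banti/esym] := init_total sX tX; apply.
Qed.

Lemma base_infinite B : barrier B -> infinite_set (base B).
Proof.
move=> [Binf _ _] fin; apply: Binf.
apply: (@sub_finite_set _ _ [set` fpowerset (fset_set (base B))]) => // s Bs /=.
rewrite fpowersetE; apply/fsubsetP => n ns.
by rewrite in_fset_set // inE; exists s.
Qed.

Lemma barrier_restrict B X : barrier B -> infinite_set X -> X `<=` base B ->
  barrier (B `&` [set s | [set` s] `<=` X]).
Proof.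
move=> bB Xinf XB; have [_ Banti Binit] := bB; split.
- move=> /finite_fsetP[F CF].
  (* If only finitely many members lay inside [X], the part of [X] beyond all of them would still
     have a nonempty initial segment in [B], which would be one more. *)
  have := @above_infinite (\bigcup_(s <- F) s)%fset _ Xinf => X'inf.
  have [|s Bs sX'] := Binit _ _ X'inf; first by apply: subset_trans XB; exact: above_sub.
  have /fset0Pn[n ns] := barrier_neq0 bB Bs.
  have sF : s \in F.
    have : (B `&` [set s | [set` s] `<=` X]) s.
      by split=> // m /sX'.1 [].
    by rewrite CF.
  have [_ /(_ n)] := sX'.1 _ ns; rewrite ltnn => /implyP; apply/negP.
  rewrite negb_imply andbT; apply/bigfcupP; exists s => //.
  by rewrite sF.
- by move=> s t [Bs _] [Bt _]; exact: Banti.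
- move=> Y YC Yinf; have YX : Y `<=` X by move=> n /YC[s [_ sX]] /sX.
  have [|//|s Bs sY] := Binit Y; first exact: subset_trans XB.
  by exists s => //; split=> //; apply: subset_trans YX; exact: sY.1.
Qed.

Lemma fset_min_mem s : s != fset0 -> fset_min s \in s.
Proof.
move=> /fset0Pn[x xs]; have : fset_min s \in incr_enum s; last by rewrite mem_sort.
have : x \in incr_enum s by rewrite mem_sort.
by rewrite /fset_min; case: (incr_enum s) => //= y l _; rewrite inE eqxx.
Qed.

Lemma fset_min_le s n : n \in s -> fset_min s <= n.
Proof.
move=> ns; have : n \in incr_enum s by rewrite mem_sort.
have : sorted leq (incr_enum s) by apply: sort_sorted; exact: leq_total.
rewrite /fset_min; case: (incr_enum s) => //= y l /(order_path_min leq_trans).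
by move=> /allP yl; rewrite inE => /predU1P[->//|/yl].
Qed.

Lemma triangle_mem s t n : triangle s t -> n \in s -> (n \in t) = (n != fset_min s).
Proof.
move=> [s0 t0 st [sub _] _] ns; apply/idP/idP => [nt|nm].
  by apply: contraTneq st => <-; rewrite -leqNgt fset_min_le.
by apply: sub; rewrite /= !inE nm.
Qed.

Lemma triangle_tail s t n :
  triangle s t -> n \in t -> n \notin s -> forall m, m \in s -> m < n.
Proof.
move=> [s0 t0 st [sub ini] _] nt ns m ms.
have [->|mm] := eqVneq m (fset_min s); first exact: leq_trans (fset_min_le nt).
rewrite ltnNge; apply: contra ns => nm.
by have /= := ini n m nt; rewrite !inE mm ms => /(_ isT nm)/andP[].
Qed.

(** The source of triangles in a barrier. Both [s] without [m] and [t] are initial segments of the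
    same set, hence comparable; [t] inside [s] would contradict the antichain condition. *)
Lemma init_triangle B X m s t : barrier B -> B s -> B t ->
  X m -> (forall n, X n -> m <= n) ->
  init s X -> init t (X `\ m) -> triangle s t.
Proof.
move=> bB Bs Bt Xm mmin sX tX.
have s0 := barrier_neq0 bB Bs; have t0 := barrier_neq0 bB Bt.
have ms : m \in s.
  by apply: (sX.2 m (fset_min s)) => //; [|apply: mmin; apply: sX.1]; exact: fset_min_mem.
have Em : fset_min s = m.
  by apply/eqP; rewrite eqn_leq fset_min_le //= mmin //; apply/sX.1/fset_min_mem.
have mt : m \notin t by apply/negP => /tX.1[_ /=]; apply.
have nts : ~ (t `<=` s)%fset.
  have [_ Banti _] := bB; move=> /(Banti _ _ Bt Bs) E.
  by rewrite E ms in mt.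
have s'X : init (s `\ m)%fset (X `\ m).
  split=> [n|n k [Xn nm]] /=; rewrite !inE => /andP[/eqP km ks].
      by split=> //; exact: sX.1.
    by move=> nk; rewrite (sX.2 n k) // andbT; apply/eqP.
have s't : (s `\ m `<=` t)%fset.
  have [//|ts] := init_total s'X tX; case: nts.
  by apply: fsubset_trans ts _; exact: fsubD1set.
split=> //; rewrite Em.
- rewrite ltn_neqAle mmin ?andbT; last by have [] := tX.1 _ (fset_min_mem t0).
  by apply: contraNneq mt => ->; exact: fset_min_mem.
- split=> [|n k nt]; first by apply/fsubsetP.
  by apply: s'X.2; exact: tX.1.
- by apply/eqP => E; apply: nts; rewrite -E; exact: fsubD1set.
Qed.

Lemma initU_min u Z : u != fset0 -> Z `<=` above u Z ->
  let X := [set` u] `|` Z in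
  [/\ X (fset_min u), forall n, X n -> fset_min u <= n
    & X `\ fset_min u = [set` (u `\ fset_min u)%fset] `|` Z].
Proof.
move=> u0 uZ /=; split; first by left; exact: fset_min_mem.
  move=> n [/fset_min_le//|/uZ [_ /(_ _ (fset_min_mem u0))]]; exact: ltnW.
apply/seteqP; split=> n /=; rewrite !inE.
  by move=> [[nu|Zn] /eqP nm]; [left; rewrite nm|right].
move=> [/andP[/eqP nm nu]|Zn]; split=> //; [by left|by right|].
have [_ /(_ _ (fset_min_mem u0))] := uZ _ Zn.
by move=> + E; rewrite -E ltnn.
Qed.

Lemma barrier_succ B s : barrier B -> B s -> exists2 t, B t & triangle s t.
Proof.
move=> bB Bs; have s0 := barrier_neq0 bB Bs; have Binf := base_infinite bB.
have [|Xm mmin Xe] := @initU_min s (above s (base B)) s0; first by rewrite above_id.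
have [_ _ Binit] := bB.
have [||t Bt tX] := Binit (([set` s] `|` above s (base B)) `\ fset_min s).
- by move=> n [[ns|[]]] // _; exists s.
- apply: infinite_setD => //; apply: sub_infinite_set (@above_infinite s _ Binf).
  by move=> n; right.
by exists t => //; apply: (init_triangle bB Bs Bt Xm mmin _ tX); exact: init_above.
Qed.

(** Any two members are linked by triangles to a common member [t] lying beyond both. The chain from
    [s] arises by deleting the minima of the finite part [u] one by one: consecutive initial
    segments form triangles, and when [u] is exhausted the initial segment of [Z] is [t]. *)
Lemma triangle_const (K : Type) B (h : {fset nat} -> K) : barrier B ->
  (forall s t, B s -> B t -> triangle s t -> h s = h t) ->
  exists k, forall s, B s -> h s = k.
Proof.
move=> bB hh; have [Binf Banti Binit] := bB.
have [s0 Bs0] := infinite_setN0 Binf.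
suff H n u Z s t : #|` u| <= n -> infinite_set Z -> Z `<=` above u Z ->
    [set` u] `<=` base B -> Z `<=` base B -> B s -> B t ->
    init s ([set` u] `|` Z) -> init t Z -> h s = h t.
  exists (h s0) => s Bs.
  pose Z := above (s `|` s0)%fset (base B).
  have Zinf : infinite_set Z by apply/above_infinite/base_infinite.
  have ZB : Z `<=` base B by apply: above_sub.
  have [t Bt tZ] := Binit Z ZB Zinf.
  have K' r : B r -> (r `<=` s `|` s0)%fset -> h r = h t.
    move=> Br rs; apply: (H _ r Z) => // [n Zn|n nr|].
    - split=> // m mr; have [_] := Zn; apply; exact: (fsubsetP rs).
    - by exists r.
    split=> [m mr|m n [//|[_ mr]] nr]; first by left.
    by have := mr n (fsubsetP rs _ nr); rewrite ltnNge => /negP.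
  by rewrite !K' // ?fsubsetUl ?fsubsetUr.
elim: n u s => [|n IH] u s un Zinf uZ uB ZB Bs Bt su tZ.
  congr h; apply: (barrier_init_uniq bB Bs Bt _ tZ).
  by move: un su; rewrite leqn0 cardfs_eq0 => /eqP->; rewrite set_fset0 set0U.
have [u0|u0] := eqVneq u fset0; first by apply: (IH u) => //; rewrite u0 cardfs0.
have [Xm mmin Xe] := initU_min u0 uZ.
have u'B : [set` (u `\ fset_min u)%fset] `<=` base B.
  by move=> m /=; rewrite !inE => /andP[_ /uB].
have [||r Br rX] := Binit ([set` (u `\ fset_min u)%fset] `|` Z).
- by move=> m [/u'B|/ZB].
- by apply: sub_infinite_set Zinf => m; right.
rewrite (hh s r) //; last by rewrite -Xe in rX; exact: (init_triangle bB _ _ Xm mmin).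
apply: (IH (u `\ fset_min u)%fset) => //.
  by move: un; rewrite (cardfsD1 (fset_min u) u) fset_min_mem.
move=> m Zm; split=> // k; rewrite !inE => /andP[_ ku].
by have [_] := uZ _ Zm; apply.
Qed.

(** Galvin's lemma for the members satisfying [Q]. In its second alternative, any [s] inside [Y]
    followed by the rest of [Y] begins with a member satisfying [Q], and that member is [s] by
    uniqueness. *)
Lemma barrier_ramsey B (Q : {fset nat} -> Prop) : barrier B ->
  exists C, [/\ barrier C, C `<=` B &
    (forall s, C s -> Q s) \/ (forall s, C s -> ~ Q s)].
Proof.
move=> bB; have Binf := base_infinite bB.
have [Y [Yinf YB H]] := galvin (B `&` Q) Binf.
exists (B `&` [set s | [set` s] `<=` Y]); split.
- exact: barrier_restrict.
- by move=> s [].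
case: H => H; [right=> s [Bs sY] Qs|left=> s [Bs sY]]; first by apply: (H s).
have [||t [Bt Qt] tX] := H ([set` s] `|` above s Y).
- apply: sub_infinite_set (@above_infinite s _ Yinf).
  by move=> n; right.
- by move=> n [/sY//|[]].
by rewrite (barrier_init_uniq bB Bs Bt (init_above _ _) tX).
Qed.

(** For a fixed [s] the successors carry finitely many colours, and Galvin's lemma, applied to their
    parts outside [s], either removes a colour or makes it the only one. Fusion then treats all [s]
    at once. *)
Lemma barrier_canonize (K : eqType) B (c : {fset nat} -> {fset nat} -> K)
    (F : {fset nat} -> seq K) : barrier B ->
  (forall s t, B s -> B t -> triangle s t -> c s t \in F s) ->
  exists C, [/\ barrier C, C `<=` B &
    exists k, forall s t, C s -> C t -> triangle s t -> c s t = k s].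
Proof.
move=> bB cF; have Binf := base_infinite bB; have [_ Banti _] := bB.
(* Successors of [s] whose new points come from [Y]; thinning [Y] leaves fewer of them. *)
pose succ s Y := [set t | [/\ B t, triangle s t & [set` t] `<=` [set` s] `|` Y]].
have succ_sub s Y Z : Z `<=` Y -> succ s Z `<=` succ s Y.
  move=> ZY t [Bt st tZ]; split=> // n /tZ[|/ZY]; by [left|right].
have [||Y [Yinf YB PY]] := @fusion
    (fun s Y => B s -> exists k, forall t, succ s Y t -> c s t = k) _ Binf.
- move=> s Y Z ZY _ PY Bs; have [k kP] := PY Bs.
  by exists k => t /(succ_sub _ _ _ ZY); exact: kP.
- move=> s Y Yinf YB; have [Bs|nBs] := pselect (B s); last by exists Y; split.
  suff [Z [Zinf ZY PZ]] : exists Z, [/\ infinite_set Z, Z `<=` Y &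
      exists k, forall t, succ s Z t -> c s t = k] by exists Z.
  have : forall t, succ s Y t -> c s t \in F s by move=> t [Bt st _]; exact: cF.
  elim: (F s) Y Yinf {YB} => [|k l IH] Y Yinf H.
    (* With no colour left there are no successors, so [c s s] is an arbitrary value. *)
    by exists Y; split=> //; exists (c s s) => t /H.
  pose Fam := [set (t `\` s)%fset | t in [set t | [/\ B t, triangle s t & c s t = k]]].
  have [Z [Zinf ZY [HZ|HZ]]] := galvin Fam Yinf.
    have [|W [Winf WZ PW]] := IH Z Zinf; last first.
      by exists W; split=> //; exact: subset_trans ZY.
    move=> t sZt; have := H _ (succ_sub _ _ _ ZY _ sZt).
    rewrite inE => /predU1P[ck|//]; case: sZt => Bt st tZ.
    case: (HZ (t `\` s)%fset); first by exists t.
    by move=> n /=; rewrite !inE => /andP[ns /tZ[/=|//]]; rewrite (negbTE ns).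
  exists Z; split=> //; exists k => t [Bt st tZ].
  have [||_ [t' [Bt' st' <-] <-] t'Z] := HZ ([set` (t `\` s)%fset] `|` above t Z).
  - by apply: sub_infinite_set (@above_infinite t _ Zinf) => n; right.
  - move=> n [/=|[//]]; rewrite !inE => /andP[ns /tZ[/=|//]].
    by rewrite (negbTE ns).
  have tZ' : init (t `\` s)%fset ([set` (t `\` s)%fset] `|` above t Z).
    split=> [n|m n [//|[_ mt]]] /=; first by left.
    by rewrite !inE => /andP[_ /mt]; rewrite ltnNge => /negP.
  (* All successors of [s] meet [s] in the same set, namely [s] without its minimum. So comparable
     tails come from comparable successors, which the antichain condition makes equal. *)
  have sub t1 t2 : triangle s t1 -> triangle s t2 ->
      (t1 `\` s `<=` t2 `\` s)%fset -> (t1 `<=` t2)%fset.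
    move=> st1 st2 /fsubsetP sub; apply/fsubsetP => n nt1.
    have [ns|ns] := boolP (n \in s).
      by rewrite (triangle_mem st2 ns) -(triangle_mem st1 ns).
    by have := sub n; rewrite !inE ns nt1 => /(_ isT).
  suff -> : t = t' by [].
  have [/(sub _ _ st st')/Banti|/(sub _ _ st' st)/Banti/esym] := init_total tZ' t'Z; exact.
exists (B `&` [set s | [set` s] `<=` Y]); split.
- exact: barrier_restrict.
- by move=> s [].
have /choice[k kP] : forall s, exists k, B s -> [set` s] `<=` Y ->
    forall t, succ s (above s Y) t -> c s t = k.
  move=> s; have [[Bs sY]|] := pselect (B s /\ [set` s] `<=` Y).
    by have [k kP] := PY s sY Bs; exists k.
  by move=> nsY; exists (c s s) => Bs sY; case: nsY.
exists k => s t [Bs sY] [Bt tY] st; apply: (kP s) => //; split=> // n nt.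
have [ns|ns] := boolP (n \in s); [by left|right; split; first exact: tY].
exact: triangle_tail st nt ns.
Qed.

(** Canonization turns the two-valued colouring of pairs into a property of [s] alone, to which the
    Ramsey lemma for members applies. *)
Lemma barrier_ramsey_triangle B (R : {fset nat} -> {fset nat} -> Prop) :
  barrier B -> exists C, [/\ barrier C, C `<=` B &
    (forall s t, C s -> C t -> triangle s t -> R s t) \/
    (forall s t, C s -> C t -> triangle s t -> ~ R s t)].
Proof.
move=> bB.
have [|C [bC CB [k kP]]] := @barrier_canonize bool B
  (fun s t => `[< R s t >]) (fun=> [:: true; false]) bB.
  by move=> s t _ _ _; case: asboolP.
have [D [bD DC H]] := barrier_ramsey k bC; exists D; split=> //.
  exact: subset_trans CB.
case: H => H; [left|right] => s t Ds Dt st; apply/asboolP.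
  by rewrite (kP s t (DC _ Ds) (DC _ Dt) st) H.
by rewrite asbool_neg (kP s t (DC _ Ds) (DC _ Dt) st); apply/negP/H.
Qed.

End Ramsey.

(** * Types of sub-barriers *)

Lemma ordinal_min (a : countable_ordinal) (A : set a) : A !=set0 ->
  exists2 x, A x & forall y, A y -> (x <= y)%O.
Proof.
move=> [x Ax]; have [|y [[yA ymin] _]] := @ordinal_wo a [pred x | `[< A x >]].
  by exists x; apply/asboolP.
move: yA => /asboolP Ay; exists y => // z Az.
by apply: ymin; apply/asboolP.
Qed.

Lemma ordinal_ind (a : countable_ordinal) (Q : a -> Prop) :
  (forall x, (forall y, (y < x)%O -> Q y) -> Q x) -> forall x, Q x.
Proof.
move=> IH x; apply: contrapT => nQ.
have [y nQy ymin] := @ordinal_min a [set x | ~ Q x] (ex_intro _ x nQ).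
apply: nQy; apply: IH => z zy; apply: contrapT => /ymin.
by rewrite leNgt zy.
Qed.

Lemma ordinal_lt_wf (a : countable_ordinal) :
  well_founded (fun x y : a => (x < y)%O).
Proof. by apply: ordinal_ind => x; exact: Acc_intro. Qed.

(** The Mostowski collapse of [S] onto an initial segment of [a], by recursion: [h x] is the least
    strict upper bound of the values at earlier points of [S]. *)
Lemma ordinal_collapse (a : countable_ordinal) (S : set a) :
  exists h : a -> a,
    (forall x y, S x -> S y -> (x < y)%O -> (h x < h y)%O) /\
    (forall x y, S x -> (y <= h x)%O -> exists2 z, S z & h z = y).
Proof.
pose bnd x (h : forall y, (y < x)%O -> a) : set a :=
  [set z | forall y (yx : (y < x)%O), S y -> (h y yx < z)%O].
pose least (A : set a) : set a := [set x | A x /\ forall y, A y -> (x <= y)%O].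
(* The least element exists because [h y <= y] for all [y < x], which makes [x] itself a strict
   upper bound. *)
pose h := Fix (@ordinal_lt_wf a) (fun=> a) (fun x h => xget x (least (bnd x h))).
have hE x : h x = xget x (least [set z | forall y, (y < x)%O -> S y -> (h y < z)%O]).
  rewrite /h Fix_eq // => {}x f g fg.
  by congr (xget _ (least (bnd _ _))); apply: functional_extensionality_dep => y;
    apply: functional_extensionality_dep.
have h_le x : least [set z | forall y, (y < x)%O -> S y -> (h y < z)%O] (h x)
    /\ (h x <= x)%O.
  elim/ordinal_ind: x => x IH.
  have bx : [set z | forall y, (y < x)%O -> S y -> (h y < z)%O] x.
    by move=> y yx _; have [_ hy] := IH y yx; exact: le_lt_trans yx.
  have [z Az zmin] := ordinal_min (ex_intro _ x bx).
  rewrite hE; case: xgetP => [w _ [Aw wmin]|/(_ z)[]//].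
  by split=> //; exact: wmin.
have h_lt x y : S x -> (x < y)%O -> (h x < h y)%O.
  by move=> Sx xy; have [[+ _] _] := h_le y; apply.
exists h; split=> [x y Sx _|x y]; first exact: h_lt.
elim/ordinal_ind: x => x IH Sx; rewrite le_eqVlt => /predU1P[->|yh].
  by exists x.
(* Some earlier [h z] reaches [y], since otherwise [y] would be a smaller strict upper bound than
   [h x]. *)
have [[z [zx Sz yz]]|nz] :=
  pselect (exists z, [/\ (z < x)%O, S z & (y <= h z)%O]); first exact: (IH z).
have [[_ hmin] _] := h_le x.
have : (h x <= y)%O.
  apply: hmin => z zx Sz; rewrite ltNge; apply/negP => yz.
  by apply: nz; exists z.
by rewrite leNgt yh.
Qed.

(** The embedding of [B] restricted to [C] may leave gaps in [a]; collapsing its image closes them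
    within the same [a]. *)
Lemma barrier_type_leS (B C : set {fset nat}) (a : countable_ordinal) :
  C `<=` B -> barrier_type_le B a -> barrier_type_le C a.
Proof.
move=> CB [g [gmono gini]].
have [h [h_lt h_ini]] := ordinal_collapse (g @` C).
exists (h \o g); split=> [s t Cs Ct|s x Cs] /=; last first.
  by move=> /h_ini[|_ [t Ct <-] <-]; [exists s|exists t].
rewrite -(gmono _ _ (CB _ Cs) (CB _ Ct)).
have [st|ts|->] := ltgtP (g s) (g t); last exact: lexx.
  by apply/ltW/h_lt.
by apply/negbTE; rewrite -ltNge; apply: h_lt.
Qed.

(** * Bad arrays *)

Section Good.
Context {d : Order.disp_t} {T : porderType d}.
Implicit Types (A : set T) (B C : set {fset nat}) (f : {fset nat} -> T).

Lemma goodS B C f : C `<=` B -> good C f -> good B f.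
Proof.
by move=> CB [s [t [/CB Bs /CB Bt st fst]]]; exists s, t.
Qed.

Lemma bqo_on_setU A1 A2 : bqo_on A1 -> bqo_on A2 -> bqo_on (A1 `|` A2).
Proof.
move=> b1 b2 a B f bB Ba fA.
have [C [bC CB HC]] := barrier_ramsey (fun s => A1 (f s)) bB.
have Ca := barrier_type_leS CB Ba; apply: (goodS CB).
case: HC => HC; first exact: b1 Ca HC.
by apply: (b2 a) => // s Cs; have [/(HC _ Cs)|] := fA _ (CB _ Cs).
Qed.

Lemma bqo_on_bigcup (A : nat -> set T) n : (forall k, bqo_on (A k)) ->
  bqo_on (\bigcup_(k in `I_n) A k).
Proof.
move=> bA; elim: n => [|n IH].
  move=> a B f bB _ fA; have [s Bs] := infinite_setN0 (barrier_infinite bB).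
  by have [k] := fA _ Bs.
rewrite bigcup_mkord big_ord_recr /= -bigcup_mkord.
exact: bqo_on_setU.
Qed.

End Good.

(** * Bad arrays in the Dress-Schiffels product *)

Section DressSchiffelsArrays.
Context {dI d : Order.disp_t} {I : porderType dI} {P : I -> bPOrderType d}.
Implicit Types (B C : set {fset nat}) (f : {fset nat} -> ds_product P).

(** At a point of difference, failure of [<] is failure of [<=], and a value not below another
    cannot be the least element. *)
Lemma ds_le_diffP (x y : ds_product P) : ~ (x <= y)%O ->
  exists i, [/\ x i <> \bot%O, maximals (ds_diff x y) i & ~ (x i <= y i)%O].
Proof.
move=> nxy; have /existsNP[i /not_implyP[maxi nlt]] :
    ~ forall i, maximals (ds_diff x y) i -> (x i < y i)%O.
  by move=> lt; apply/nxy/asboolP.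
have nle : ~ (x i <= y i)%O.
  by rewrite le_eqVlt => /orP[/eqP|//]; case: maxi.
by exists i; split=> // xi; apply: nle; rewrite xi le0x.
Qed.

Lemma bad_ds_array B f : barrier B -> ~ good B f ->
  exists C, [/\ barrier C, C `<=` B &
    (exists i : {fset nat} -> I,
       (forall s, C s -> f s (i s) <> \bot%O) /\ ~ good C i) \/
    (exists i : I,
       (forall s, C s -> f s i <> \bot%O) /\ ~ good C (fun s => f s i))].
Proof.
move=> bB bad.
have ex s t : B s -> B t -> triangle s t -> exists i,
    [/\ f s i <> \bot%O, maximals (ds_diff (f s) (f t)) i & ~ (f s i <= f t i)%O].
  move=> Bs Bt st; apply: ds_le_diffP => fst.
  by apply: bad; exists s, t.
have [i0 _] : exists i0 : I, True.
  have [s Bs] := infinite_setN0 (barrier_infinite bB).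
  by have [t Bt /ex[]// i] := barrier_succ bB Bs; exists i.
pose c s t := xget i0 [set i |
  [/\ f s i <> \bot%O, maximals (ds_diff (f s) (f t)) i & ~ (f s i <= f t i)%O]].
have cP s t : B s -> B t -> triangle s t ->
   [/\ f s (c s t) <> \bot%O, maximals (ds_diff (f s) (f t)) (c s t) &
     ~ (f s (c s t) <= f t (c s t))%O].
  by move=> Bs Bt st; exact: (xgetPex i0 (ex s t Bs Bt st)).
pose supp s : {fset I} := fset_set [set i | f s i <> \bot%O].
have suppP s i : i \in supp s <-> f s i <> \bot%O.
  by rewrite in_fset_set ?inE //; exact: ds_finite_support.
have [|C [bC CB [i iP]]] := @barrier_canonize I B c (fun s => supp s) bB.
  by move=> s t Bs Bt st; apply/suppP; have [] := cP s t Bs Bt st.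
have {iP}cP s t : C s -> C t -> triangle s t ->
   [/\ f s (i s) <> \bot%O, maximals (ds_diff (f s) (f t)) (i s) &
     ~ (f s (i s) <= f t (i s))%O].
  by move=> Cs Ct st; rewrite -(iP _ _ Cs Ct st); apply: cP => //; exact: CB.
have {}suppP' s : C s -> f s (i s) <> \bot%O.
  by move=> Cs; have [t Ct /cP[]] := barrier_succ bC Cs.
have [D [bD DC HD]] := barrier_ramsey_triangle (fun s t => (i s <= i t)%O) bC.
have DB := subset_trans DC CB.
(* If [i s <= i t] fails on every triangle, [i] is bad. Otherwise it holds on every triangle, and a
   second application of Ramsey separates equality from strict increase. *)
case: HD => HD; last first.
  exists D; split=> //; left; exists i; split=> [s /DC|]; first exact: suppP'.
  by move=> [s [t [Ds Dt st]]]; exact: HD.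
have [E [bE ED HE]] := barrier_ramsey_triangle (fun s t => i s = i t) bD.
case: HE => HE.
  have [j jP] := triangle_const bE HE.
  exists E; split=> //; first exact: subset_trans DB.
  right; exists j; split=> [s Es|].
    by rewrite -(jP _ Es); exact/suppP'/DC/ED.
  move=> [s [t [Es Et st]]]; rewrite -(jP _ Es).
  by have [] := cP s t (DC _ (ED _ Es)) (DC _ (ED _ Et)) st.
have lt s t : E s -> E t -> triangle s t -> (i s < i t)%O.
  move=> Es Et st; rewrite lt_neqAle HD //; try exact: ED.
  by rewrite andbT; apply/eqP; exact: HE.
pose rk s := #|` [fset j in supp s | (i s < j)%O]%fset|.
have [s Es] := infinite_setN0 (barrier_infinite bE).
(* Along a triangle the support above [i s] strictly shrinks: [f s] and [f t]
   agree above [i s], and [i t] is lost. *)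
exfalso; have [n] := ubnP (rk s); elim: n s Es => // n IH s Es rkn.
have [t Et st] := barrier_succ bE Es; apply: (IH t Et).
rewrite -ltnS; apply: leq_trans rkn; rewrite ltnS.
have [Cs Ct] := (DC _ (ED _ Es), DC _ (ED _ Et)).
have agree j : (i s < j)%O -> f s j = f t j.
  have [_ [_ +] _] := cP s t Cs Ct st.
  by move=> /(_ j) maxi ij; apply: contrapT => /maxi; rewrite ij.
have it : i t \in [fset j in supp s | (i s < j)%O]%fset.
  rewrite !inE lt // andbT; apply/suppP; rewrite agree; last exact: lt.
  exact: suppP'.
apply: fproper_ltn_card; rewrite fproperE; apply/andP; split.
  apply/fsubsetP => j; rewrite !inE => /andP[jt tj].
  have sj := lt_trans (lt s t Es Et st) tj.
  by rewrite sj andbT; apply/suppP; rewrite agree //; exact/suppP.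
by apply/fsubsetPn; exists (i t) => //; rewrite !inE ltxx andbF.
Qed.

End DressSchiffelsArrays.

(** * Sequences as arrays on singletons, and wqo *)

Definition singletons : set {fset nat} := range (fun n => [fset n]%fset).

Lemma singletons_barrier : barrier singletons.
Proof.
split.
- have /Pinj[g gE] : set_inj [set: nat] (fun n => [fset n]%fset).
    by move=> m n _ _ /fset1_inj.
  by rewrite /singletons gE (eq_finite_set (card_image g)); exact: infinite_nat.
- by move=> _ _ [m _ <-] [n _ <-]; rewrite fsub1set inE => /eqP->.
- move=> X _ /infinite_setN0/nat_set_min[m Xm mmin].
  exists [fset m]%fset; first by exists m.
  split=> [n /=|n k Xn /=]; rewrite !inE => /eqP-> // nm.
  by rewrite eqn_leq nm mmin.
Qed.

Lemma infinite_injection (T : Type) (A : set T) : infinite_set A ->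
  exists2 u : nat -> T, (forall n, A (u n)) & injective u.
Proof.
elim/Ppointed: T => T in A *; first by rewrite emptyE => /(_ (finite_set0 _)).
move=> /infiniteP/pcard_leP/injfunPex[u uA uinj]; exists u => [n|m n].
  exact: uA.
by apply: uinj; rewrite inE.
Qed.

Lemma fset_min1 k : fset_min [fset k]%fset = k.
Proof.
apply/eqP; rewrite -in_fset1.
by apply/fset_min_mem/fset0Pn; exists k; rewrite inE.
Qed.

Lemma triangle_fset1 m n : triangle [fset m]%fset [fset n]%fset <-> (m < n)%N.
Proof.
have neq0 k : [fset k]%fset != fset0 :> {fset nat}.
  by apply/fset0Pn; exists k; rewrite inE.
have E : ([fset m] `\ m)%fset = fset0 :> {fset nat}.
  by apply/fsetP => k; rewrite !inE andNb.
rewrite /triangle !fset_min1 E; split=> [[]//|mn]; split=> //; last by rewrite eq_sym.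
Qed.

Section Wqo.
Context {d : Order.disp_t} {T : porderType d}.

(** On a bad array, Ramsey for [f t <= f s] gives either a strictly decreasing sequence along
    successors or an infinite antichain. For the antichain, distinct singletons form a triangle in
    one of the two orders, so incomparability reaches all pairs. *)
Lemma wqo_good (C : set {fset nat}) (f : {fset nat} -> T) :
  wqo T -> barrier C -> C `<=` singletons -> good C f.
Proof.
move=> [noanti nodesc] bC CS; apply: contrapT => bad.
have [D [bD DC HD]] := barrier_ramsey_triangle (fun s t => (f t <= f s)%O) bC.
have nle s t : D s -> D t -> triangle s t -> ~ (f s <= f t)%O.
  by move=> /DC Cs /DC Ct st fst; apply: bad; exists s, t.
case: HD => HD.
  have /choice[g gP] : forall s, exists t, D s -> D t /\ triangle s t.
    move=> s; have [Ds|nDs] := pselect (D s); last by exists s.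
    by have [t] := barrier_succ bD Ds; exists t.
  have [s Ds] := infinite_setN0 (barrier_infinite bD).
  have Dg n : D (iter n g s) by elim: n => //= n /gP[].
  apply: nodesc; exists (fun n => f (iter n g s)) => n.
  have [Dn st] := gP _ (Dg n); rewrite lt_leAnge /= HD //=.
  by apply/negP; exact: nle.
have incomp s t : D s -> D t -> s <> t -> (f s >< f t)%O.
  suff H m n : (m < n)%N -> D [fset m]%fset -> D [fset n]%fset ->
      (f [fset m]%fset >< f [fset n]%fset)%O.
    move=> Ds Dt st; have [m _ ms] := CS _ (DC _ Ds); have [n _ nt] := CS _ (DC _ Dt).
    rewrite -{}ms -{}nt in Ds Dt st *.
    have [mn|nm|mn] := ltngtP m n; [exact: H| |by rewrite mn in st].
    by rewrite comparable_sym; exact: H.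
  move=> /triangle_fset1 st Ds Dt; rewrite /Order.comparable.
  by apply/norP; split; apply/negP; [exact: nle|exact: HD].
have finj : set_inj D f.
  move=> s t; rewrite !inE => Ds Dt fst; apply: contrapT => /(incomp _ _ Ds Dt).
  by rewrite fst comparablexx.
apply: noanti; exists (f @` D); split.
  case/Pinj: finj => g ->; rewrite (eq_finite_set (card_image g)).
  exact: barrier_infinite.
move=> _ _ [s Ds <-] [t Dt <-] fst; apply: incomp => // st.
by apply: fst; rewrite st.
Qed.

Lemma good_wqo : (forall f : {fset nat} -> T, good singletons f) -> wqo T.
Proof.
move=> allgood.
have incr (u : nat -> T) : exists m n, (m < n)%N /\ (u m <= u n)%O.
  (* A sequence becomes an array by reading [u] at the only element of a singleton. *)
  have [s [t [[m _ <-] [n _ <-] /triangle_fset1 mn]]] := allgood (u \o fset_min).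
  rewrite /= !fset_min1; by exists m, n.
split.
  move=> [A [/infinite_injection[u uA uinj] Aanti]].
  have [m [n [mn]]] := incr u.
  have := Aanti _ _ (uA m) (uA n); rewrite /Order.comparable.
  move=> /(_ _)/norP[|/negP + _ //].
  by move=> /uinj E; rewrite E ltnn in mn.
move=> [u udesc]; have [m [n [mn]]] := incr u.
suff : (u n < u m)%O by move=> /lt_geF->.
elim: n mn => // n IH; rewrite ltnS leq_eqVlt => /predU1P[->//|/IH].
exact: lt_trans.
Qed.

End Wqo.

Theorem mainTheorem9 (dI d : Order.disp_t) (I : porderType dI)
    (P : I -> bPOrderType d) :
  (forall a : countable_ordinal, infinite_set [set: a]%classic ->
     alpha_wqo I a -> (forall i, alpha_wqo (P i) a) ->
     alpha_wqo (ds_product P) a) /\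
  (bqo I -> (forall i, bqo (P i)) -> bqo (ds_product P)) /\
  (sigma_bqo I -> (forall i, sigma_bqo (P i)) -> sigma_bqo (ds_product P)).
Proof.
(* The sub-barrier carrying the bad array in [I] or in some [P i] has its type bounded by the same
   [a], so (a) and (b) both follow. *)
have alpha a : alpha_wqo I a -> (forall i, alpha_wqo (P i) a) ->
    alpha_wqo (ds_product P) a.
  move=> wI wP B f bB Ba _; apply: contrapT => /(bad_ds_array bB)[C [bC CB HC]].
  have Ca := barrier_type_leS CB Ba.
  case: HC => [[i [_]]|[i [_]]]; apply; [exact: wI|exact: (wP i)].
split=> [a _|]; first exact: alpha.
split=> [bI bP a|[wI [A [AT bA]]] sP].
  by apply: alpha => [|i]; [exact: bI|exact: bP].
split.
  (* A bad sequence in the product would yield a bad array in [I] or in some [P i] on a sub-barrier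
     of the singletons, against wqo there. *)
  apply: good_wqo => f; apply: contrapT.
  move=> /(bad_ds_array singletons_barrier)[C [bC CS HC]].
  case: HC => [[i [_]]|[i [_]]]; apply; apply: wqo_good => //.
  by case: (sP i).
have /all_sig[Q QP] : forall i, {Q : nat -> set (P i) |
    \bigcup_n Q n = [set: P i] /\ forall n, bqo_on (Q n)}.
  by move=> i; apply: cid; case: (sP i).
exists (fun n => [set f : ds_product P | forall i, f i <> \bot%O ->
  (\bigcup_(k in `I_n) A k) i /\ (\bigcup_(k in `I_n) Q i k) (f i)]); split.
  apply/seteqP; split=> // f _.
  have /finite_seqP[s sE] := ds_finite_support f.
  suff [n nP] : exists n, forall i, i \in s ->
      (\bigcup_(k in `I_n) A k) i /\ (\bigcup_(k in `I_n) Q i k) (f i).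
    exists n => // i fi; apply: nP.
    by have : [set i | f i <> \bot%O] i by []; rewrite sE.
  elim: s {sE} => [|j s [n nP]]; first by exists 0%N.
  have [k _ Ak] : (\bigcup_n A n) j by rewrite AT.
  have [l _ Ql] : (\bigcup_n Q j n) (f j) by rewrite (QP j).1.
  (* The successor is taken because the pieces are indexed by [k < n]; the maximum serves the new
     point [j] and the earlier ones together. *)
  exists (maxn n (maxn k l)).+1 => i; rewrite inE => /predU1P[->|/nP].
    split; [exists k|exists l] => //=; rewrite ltnS !leq_max leqnn ?orbT //.
  have sub m : (m < n -> m < (maxn n (maxn k l)).+1)%N.
    by move=> mn; rewrite ltnS leq_max ltnW.
  by move=> [[p pn Ap] [q qn Qq]]; split; [exists p|exists q] => //; exact: sub.
move=> n a B f bB Ba fS; apply: contrapT => /(bad_ds_array bB)[C [bC CB HC]].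
have Ca := barrier_type_leS CB Ba.
(* The nonvanishing clause [fi] places the indices, respectively the coordinates, in the first [n]
   pieces, whose finite union is bqo. *)
case: HC => [[i [fi]]|[i [fi]]]; apply.
  apply: (bqo_on_bigcup (n := n) bA) Ca _ => // s Cs.
  by have [] := fS s (CB _ Cs) _ (fi s Cs).
apply: (bqo_on_bigcup (n := n) (QP i).2) Ca _ => // s Cs.
by have [] := fS s (CB _ Cs) _ (fi s Cs).
Qed.
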